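(* For all $n\geq3$ and $k\geq3$, the $3$-restricted edge-connectivity of the DCell satisfies $\lambda_3(D_{k,n})=3n+3k-9$.
   Context: DCell $D_{k,n}$ ($n\geq 2$, $k\geq 0$) is defined recursively. $D_{0,n}$ is the complete graph $K_n$ on vertices $0,1,\dots,n-1$. Let $t_{k,n}=|V(D_{k,n})|$. For $k\geq1$, $D_{k,n}$ is built from $t_{k-1,n}+1$ disjoint copies $D^0_{k-1,n},\dots,D^{t_{k-1,n}}_{k-1,n}$ of $D_{k-1,n}$; a vertex of copy $D^i_{k-1,n}$ is labeled $(i,a_{k-1},\dots,a_0)$, where $(a_{k-1},\dots,a_0)$ is its label in $D_{k-1,n}$, and its index within the copy is $uid_{k-1}=a_0+\sum_{l=1}^{k-1}a_l t_{l-1,n}$. For each pair $a<b$ of copy indices, one edge joins the vertex of $D^a_{k-1,n}$ with $uid_{k-1}=b-1$ to the vertex of $D^b_{k-1,n}$ with $uid_{k-1}=a$. An edge set $F$ is a $3$-restricted edge-cut of $G$ if $G-F$ is disconnected and every component of $G-F$ has at least $3$ vertices; $\lambda_3(G)$ is the minimum size of such a cut. *)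

(* Defs.v *)
(* Mathematical Components world. *)
From HB Require Import structures.
From mathcomp Require Import all_boot.

Set Implicit Arguments.
Unset Strict Implicit.
Unset Printing Implicit Defensive.

Record sgraph := SGraph {
  vertex :> finType;
  adj : rel vertex;
  adj_sym : symmetric adj;
  adj_irr : irreflexive adj }.

(* An edge is the unordered pair of its ends. *)
Definition edges (G : sgraph) : {set {set G}} :=
  [set [set p.1; p.2] | p : G * G & adj p.1 p.2].

Definition del_adj (G : sgraph) (F : {set {set G}}) : rel G :=
  fun x y => adj x y && ([set x; y] \notin F).

Lemma del_adj_sym (G : sgraph) (F : {set {set G}}) : symmetric (del_adj F).
Proof. by move=> x y; rewrite /del_adj adj_sym setUC. Qed.

Lemma del_adj_irr (G : sgraph) (F : {set {set G}}) : irreflexive (del_adj F).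
Proof. by move=> x; rewrite /del_adj adj_irr. Qed.

Definition del_edges (G : sgraph) (F : {set {set G}}) : sgraph :=
  SGraph (@del_adj_sym G F) (@del_adj_irr G F).

Definition connected (G : sgraph) : Prop :=
  forall x y : G, connect (@adj G) x y.

Definition component (G : sgraph) (x : G) : {set G} :=
  [set y | connect (@adj G) x y].

Definition restricted_edge_cut (h : nat) (G : sgraph) (F : {set {set G}}) :
    Prop :=
  [/\ F \subset edges G,
      ~ connected (del_edges F)
    & forall x : del_edges F, h <= #|component x|].

(* "lambda_h(G) exists and equals m"; lambda_h is undefined for a graph without
   h-restricted edge-cuts. *)
Definition restricted_edge_connectivity_is (h : nat) (G : sgraph) (m : nat) :
    Prop :=
  (exists2 F : {set {set G}}, restricted_edge_cut h F & #|F| = m) /\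
  (forall F : {set {set G}}, restricted_edge_cut h F -> m <= #|F|).

(* The label (a_k, ..., a_0) is the nested pair (a_k, (..., (a_1, a_0))). *)
Fixpoint dcell_vertex (n k : nat) : finType :=
  if k is k'.+1 then
    ('I_(#|dcell_vertex n k'|.+1) * dcell_vertex n k')%type
  else 'I_n.

(* t_{k,n} *)
Definition dcell_order (n k : nat) : nat := #|dcell_vertex n k|.

(* uid_k(a_k, ..., a_0) = a_0 + \sum_(1 <= l < k.+1) a_l * t_{l-1,n} *)
Fixpoint dcell_uid (n k : nat) : dcell_vertex n k -> nat :=
  match k return dcell_vertex n k -> nat with
  | 0 => fun a => nat_of_ord a
  | k'.+1 => fun x => dcell_uid x.2 + x.1 * dcell_order n k'
  end.

(* The edge joining copies a < b, with x in copy a and y in copy b. *)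
Definition dcell_link (n k : nat) (x y : dcell_vertex n k.+1) : bool :=
  [&& x.1 < y.1, dcell_uid x.2 == y.1 - 1 & dcell_uid y.2 == x.1].

Fixpoint dcell_adj (n k : nat) : rel (dcell_vertex n k) :=
  match k return rel (dcell_vertex n k) with
  | 0 => fun x y => x != y
  | k'.+1 => fun x y =>
      [|| (x.1 == y.1) && dcell_adj x.2 y.2, dcell_link x y | dcell_link y x]
  end.

Lemma dcell_adj_sym (n k : nat) : symmetric (@dcell_adj n k).
Proof.
elim: k => [|k IH] x y /=; first by rewrite eq_sym.
by rewrite eq_sym IH; congr (_ || _); rewrite orbC.
Qed.

Lemma dcell_adj_irr (n k : nat) : irreflexive (@dcell_adj n k).
Proof.
elim: k => [|k IH] x /=; first by rewrite eqxx.
by rewrite IH andbF /dcell_link ltnn.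
Qed.

Definition dcell (n k : nat) : sgraph :=
  SGraph (@dcell_adj_sym n k) (@dcell_adj_irr n k).

(* Main.v *)
(* A clique X of three vertices in a K_n has 3(n + k - 1) - 6 boundary edges, and
   deleting them leaves components of size at least 3 because all degrees are
   at least 5. Conversely, every X with |X| >= 3 and |V \ X| >= 3 has at least
   that many boundary edges, by induction on k, together with the bounds
   n + k - 1 and (for k >= 2) 2(n + k - 2) for the thresholds 1 and 2. Let T be
   the order of one copy. If X contains a copy and misses another one, then the
   links give T boundary edges. Otherwise, up to complementation, X contains no
   copy; if X meets three copies, each contributes n + k - 1; if it meets at most
   two, all but at most two of its vertices have a boundary link, and the
   induction hypothesis applies to the traces of X on the copies. Sets with
   |X| <= n are handled by regularity: at least |X|(n + k - |X|) boundary edges.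
*)
Require Import Defs.
From mathcomp Require Import all_boot.
From mathcomp Require Import zify.

Set Implicit Arguments.
Unset Strict Implicit.
Unset Printing Implicit Defensive.

(** * Edge boundaries of vertex sets *)

Section Boundary.

Variables (V : finType) (e : rel V).

Definition boundary (A : {set V}) : nat :=
  \sum_(x in A) \sum_(y in ~: A) e x y.

Lemma boundaryE (A : {set V}) :
  boundary A = \sum_x \sum_y [&& e x y, x \in A & y \notin A].
Proof.
rewrite /boundary big_mkcond; apply: eq_bigr => x _; case: ifP => _.
  rewrite big_mkcond; apply: eq_bigr => y _; rewrite inE andTb.
  by case: (y \in A); rewrite /= ?andbF ?andbT.
by rewrite big1 // => y _; rewrite andbF.
Qed.

Lemma boundary_card (A : {set V}) :
  boundary A = #|[set p : V * V | [&& e p.1 p.2, p.1 \in A & p.2 \notin A]]|.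
Proof.
rewrite boundaryE pair_bigA /= -sum1dep_card [RHS]big_mkcond.
by apply: eq_bigr => p _; case: ifP.
Qed.

Lemma boundaryC (A : {set V}) :
  symmetric e -> boundary (~: A) = boundary A.
Proof.
move=> e_sym; rewrite /boundary setCK exchange_big.
by apply: eq_bigr => x _; apply: eq_bigr => y _; rewrite e_sym.
Qed.

Lemma card_nbrs_split (A : {set V}) (x : V) :
  \sum_y e x y = \sum_(y in A) e x y + \sum_(y in ~: A) e x y.
Proof.
by rewrite (bigID (mem A)) /=; congr addn; apply: eq_bigl => y; rewrite !inE.
Qed.

(** A vertex of [A] has at most [#|A| - 1] of its [d] neighbours inside [A]; [boundary_clique] is
    the case of equality. *)
Lemma boundary_small (d : nat) (A : {set V}) :
  irreflexive e -> (forall x, \sum_y e x y = d) ->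
  #|A| * (d.+1 - #|A|) <= boundary A.
Proof.
move=> e_irr deg; rewrite -sum_nat_const; apply: leq_sum => x xA.
have := deg x; rewrite (card_nbrs_split A) => degx.
have : \sum_(y in A) e x y = \sum_(y in A | y != x) e x y.
  by rewrite (bigD1 x xA) /= e_irr.
have : \sum_(y in A | y != x) e x y <= #|A| - 1.
  have -> : #|A| - 1 = #|A :\ x| by rewrite (cardsD1 x A) xA addKn.
  rewrite -sum1_card; under [X in _ <= X]eq_bigl => y do rewrite !inE andbC.
  by apply: leq_sum => y _; case: (e x y).
have : 0 < #|A| by apply/card_gt0P; exists x.
lia.
Qed.

Lemma boundary_clique (d : nat) (A : {set V}) :
    irreflexive e -> (forall x, \sum_y e x y = d) ->
    {in A &, forall x y, x != y -> e x y} ->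
  boundary A = #|A| * (d.+1 - #|A|).
Proof.
move=> e_irr deg clique; rewrite -sum_nat_const; apply: eq_bigr => x xA.
have : \sum_(y in A) e x y = #|A| - 1.
  have -> : #|A| - 1 = #|A :\ x| by rewrite (cardsD1 x A) xA addKn.
  rewrite (bigD1 x xA) /= e_irr add0n -sum1_card.
  apply: eq_big => y; first by rewrite !inE andbC.
  by case/andP=> yA yx; rewrite clique // eq_sym.
have := deg x; rewrite (card_nbrs_split A).
have : 0 < #|A| by apply/card_gt0P; exists x.
lia.
Qed.

(* Both [A] and its complement have at least [s] elements. *)
Definition isoperimetric (s c : nat) : Prop :=
  forall A : {set V}, s <= #|A| -> #|A| + s <= #|V| -> c <= boundary A.

End Boundary.

(** * Copies of a graph, any two joined by a single link *)

Section Layer.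

(* One recursion step: [E] consists of copies of [e] indexed by [I], and
   [port i j] is the end, in copy [i], of the unique edge between copies [i] and
   [j]. By [card_port] every vertex of copy [i] is [port i j] for one [j]. *)
Variables (I V : finType) (e : rel V).
Variables (E : rel (I * V)) (port : I -> I -> V).
Hypothesis E_same : forall i u v, E (i, u) (i, v) = e u v.
Hypothesis E_diff : forall i j u v, i != j ->
  E (i, u) (j, v) = (u == port i j) && (v == port j i).
Hypothesis card_port : forall i (A : {set V}),
  \sum_(j | j != i) (port i j \in A) = #|A|.

Lemma sum_copies (F : I * V -> nat) : \sum_p F p = \sum_i \sum_v F (i, v).
Proof. by rewrite pair_bigA; apply: eq_bigr => -[]. Qed.

Definition slice (X : {set I * V}) (i : I) : {set V} := [set v | (i, v) \in X].

(** The sum runs over ordered pairs, with the end inside [X] first, so each link leaving [X] counts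
    once. *)
Definition crossing (X : {set I * V}) : nat :=
  \sum_i \sum_(j | j != i)
     ((port i j \in slice X i) && (port j i \notin slice X j)).

Lemma card_slices (X : {set I * V}) : #|X| = \sum_i #|slice X i|.
Proof.
rewrite -sum1_card big_mkcond /=.
rewrite sum_copies.
apply: eq_bigr => i _; rewrite -sum1_card [RHS]big_mkcond /=.
by apply: eq_bigr => v _; rewrite inE.
Qed.

Lemma sliceC (X : {set I * V}) (i : I) : slice (~: X) i = ~: slice X i.
Proof. by apply/setP => v; rewrite !inE. Qed.

Lemma sum_pair_eq (u0 v0 : V) (P : V -> V -> bool) :
  \sum_u \sum_v [&& (u == u0) && (v == v0) & P u v] = P u0 v0.
Proof.
rewrite (bigD1 u0) //= (bigD1 v0) //= !eqxx /=.
rewrite big1 => [|v /negbTE ->] //.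
rewrite big1 => [|u /negbTE ->]; first by rewrite !addn0.
by rewrite big1.
Qed.

Lemma boundary_layer (X : {set I * V}) :
  boundary E X = \sum_i boundary e (slice X i) + crossing X.
Proof.
rewrite boundaryE sum_copies.
rewrite /crossing -big_split /=; apply: eq_bigr => i _.
transitivity (\sum_j \sum_u \sum_v
    [&& E (i, u) (j, v), u \in slice X i & v \notin slice X j]).
  rewrite [RHS]exchange_big; apply: eq_bigr => u _ /=; rewrite sum_copies.
  by apply: eq_bigr => j _; apply: eq_bigr => v _; rewrite !inE.
rewrite (bigD1 i) //=; congr (_ + _).
  rewrite boundaryE; apply: eq_bigr => u _; apply: eq_bigr => v _.
  by rewrite E_same.
apply: eq_bigr => j ji; rewrite -(sum_pair_eq (port i j) (port j i)
  (fun u v => (u \in slice X i) && (v \notin slice X j))).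
by apply: eq_bigr => u _; apply: eq_bigr => v _; rewrite E_diff // eq_sym.
Qed.

Lemma degree_layer (d : nat) :
  (forall x, \sum_y e x y = d) -> forall x, \sum_y E x y = d.+1.
Proof.
move=> deg [i u]; rewrite sum_copies.
rewrite (bigD1 i) //=; under eq_bigr => v _ do rewrite E_same.
rewrite deg -addn1; congr (_ + _).
(* The extra 1 is the only link at [u]: [card_port] for the singleton of [u]. *)
rewrite -(cards1 u) -(card_port i); apply: eq_bigr => j ji.
under eq_bigr => v _ do rewrite E_diff 1?eq_sym //.
rewrite (bigD1 (port j i)) //= eqxx andbT inE big1 ?addn0 // => v.
by move=> /negbTE ->; rewrite andbF.
Qed.

Lemma crossing_full_empty (X : {set I * V}) :
  #|[set i | slice X i == setT]| * #|[set i | slice X i == set0]| <= crossing X.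
Proof.
rewrite -sum_nat_const /crossing big_mkcond; apply: leq_sum => i _.
case: ifP => //; rewrite inE => /eqP Xi.
rewrite -sum1_card [X in X <= _]big_mkcond [X in _ <= X]big_mkcond.
apply: leq_sum => j _; rewrite inE; case: ifP => // /eqP Xj.
case: eqVneq => [ji | _]; last by rewrite Xi Xj !inE.
have := in_set0 (port i i); have := in_setT (port i i).
by rewrite -Xi -Xj ji => ->.
Qed.

(** Each vertex of [X] has one link. If that link does not cross, it leads to another copy in [M],
    and there are only [#|M| * #|M|.-1] ordered pairs of distinct copies in [M]. *)
Lemma crossing_sparse (X : {set I * V}) (M := [set i | slice X i != set0]) :
  #|X| <= crossing X + #|M| * #|M|.-1.
Proof.
have -> : #|X| = \sum_(i in M) #|slice X i|.
  rewrite card_slices (bigID (mem M)) /= [X in _ + X]big1 ?addn0 // => i.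
  by rewrite inE negbK => /eqP ->; rewrite cards0.
have crM : \sum_(i in M) \sum_(j | j != i)
     ((port i j \in slice X i) && (port j i \notin slice X j)) <= crossing X.
  by rewrite /crossing [X in _ <= X](bigID (mem M)) leq_addr.
apply: leq_trans (leq_add crM (leqnn _)).
rewrite -sum_nat_const -big_split /=; apply: leq_sum => i iM.
have -> : #|M|.-1 = \sum_(j | j != i) (j \in M).
  rewrite (cardsD1 i M) iM /= -sum1_card big_mkcond [RHS]big_mkcond.
  by apply: eq_bigr => j _; rewrite !inE; do 2 case: (_ != _).
rewrite -(card_port i) -big_split; apply: leq_sum => j _ /=.
case: (port i j \in _) => //=; rewrite [j \in _]inE.
by case: eqVneq => [-> | _]; rewrite ?inE // addn1.
Qed.

(** With [p] full, [q] empty and [r] other copies, the boundary is at least [p * q + r]. As [p] and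
    [q] are positive, [p * q >= p + q - 1], and [p + q + r = #|V| + 1]. *)
Lemma boundary_full_empty (X : {set I * V}) (i j : I) :
    #|I| = #|V|.+1 -> isoperimetric e 1 1 ->
  slice X i = setT -> slice X j = set0 -> #|V| <= boundary E X.
Proof.
move=> cardI iso1 Xi Xj.
set p := #|[set i | slice X i == setT]|.
set q := #|[set i | slice X i == set0]|.
have p0 : 0 < p by apply/card_gt0P; exists i; rewrite inE Xi.
have q0 : 0 < q by apply/card_gt0P; exists j; rewrite inE Xj.
(* A copy that is neither full nor empty contributes a boundary edge. *)
have le_pqb : #|I| <= p + q + \sum_i boundary e (slice X i).
  rewrite -sum1_card /p /q -!sum1dep_card big_mkcond.
  rewrite [\sum_(_ | _ == setT) _]big_mkcond [\sum_(_ | _ == set0) _]big_mkcond.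
  rewrite -!big_split; apply: leq_sum => l _ /=.
  case: eqVneq => //= XlT; case: eqVneq => //= Xl0.
  rewrite !add0n; apply: iso1; first by rewrite card_gt0.
  by rewrite addn1 -cardsT proper_card // properT.
have := crossing_full_empty X; rewrite -/p -/q boundary_layer.
nia.
Qed.

(** Reduces to sets without a full copy: a full and an empty copy together already give [#|V|]
    edges, and if no copy is empty, the complement has no full copy. *)
Lemma isoperimetric_layer (s c : nat) :
    symmetric E -> #|I| = #|V|.+1 -> isoperimetric e 1 1 -> c <= #|V| ->
    (forall X : {set I * V}, s <= #|X| -> (forall i, #|slice X i| < #|V|) ->
      c <= boundary E X) ->
  isoperimetric E s c.
Proof.
move=> E_sym cardI iso1 cV H X sX sXC.
have nonfull (Y : {set I * V}) :
    [forall i, slice Y i != setT] -> forall i, #|slice Y i| < #|V|.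
  by move=> /forallP Y_nfull i; rewrite -cardsT proper_card // properT.
have [/nonfull | ] := boolP [forall i, slice X i != setT]; first exact: H.
rewrite negb_forall => /existsP[i]; rewrite negbK => /eqP Xi.
have [/existsP[j /eqP Xj] | ] := boolP [exists j, slice X j == set0].
  exact: leq_trans (boundary_full_empty cardI iso1 Xi Xj).
rewrite negb_exists -(boundaryC _ E_sym) => /forallP nempty.
apply: H; first by move: sXC; rewrite -(cardsC X) leq_add2l.
apply: nonfull; apply/forallP => j; rewrite sliceC.
by apply: contra (nempty j) => /eqP eqT; rewrite -[slice X j]setCK eqT setCT.
Qed.

(** The cases are at least three, one, or two copies met by [X]. In the last, the 2 allows for both
    ends of the link between the two copies, which may lie inside [X]. *)
Lemma boundary_sparse (X : {set I * V}) (a : nat) :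
    isoperimetric e 1 a -> (forall i, #|slice X i| < #|V|) -> 0 < #|X| ->
  [\/ 3 * a <= boundary E X,
      exists2 i, #|slice X i| = #|X| &
        boundary e (slice X i) + #|X| <= boundary E X
    | exists i j, [/\ 0 < #|slice X i|, 0 < #|slice X j|,
        #|slice X i| + #|slice X j| = #|X| &
        boundary e (slice X i) + boundary e (slice X j) + #|X|
          <= boundary E X + 2]].
Proof.
move=> iso1 nfull X0; rewrite boundary_layer.
have /= := crossing_sparse X; set M := [set i | _] => crX.
have sumM (F : {set V} -> nat) : F set0 = 0 ->
    \sum_i F (slice X i) = \sum_(i in M) F (slice X i).
  move=> F0; rewrite (bigID (mem M)) /= [X in _ + X]big1 ?addn0 // => i.
  by rewrite inE negbK => /eqP ->.
have b0 : boundary e set0 = 0 by rewrite /boundary big_set0.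
have cardX := card_slices X.
rewrite (sumM (fun A => #|A|)) ?cards0 // in cardX.
rewrite (sumM _ b0).
have M0 i : i \in M -> 0 < #|slice X i| by rewrite inE card_gt0.
have [/cards1P[i Mi] | M1] := boolP (#|M| == 1).
  constructor 2; exists i; first by rewrite cardX Mi big_set1.
  by move: crX; rewrite Mi cards1 big_set1 muln0 addn0 leq_add2l.
have [/cards2P[i [j [ij Mij]]] | M2] := boolP (#|M| == 2).
  constructor 3; exists i, j; split.
  - by apply: M0; rewrite Mij set21.
  - by apply: M0; rewrite Mij set22.
  - by rewrite cardX Mij big_setU1 ?inE // big_set1.
  move: crX; rewrite Mij cards2 ij big_setU1 ?inE // big_set1 /=; lia.
constructor 1.
have M_neq0 : #|M| != 0.
  by apply: contraL X0 => /eqP/cards0_eq M_0; rewrite cardX M_0 big_set0.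
have : #|M| * a <= \sum_(i in M) boundary e (slice X i).
  rewrite -sum_nat_const; apply: leq_sum => i iM; apply: iso1; first exact: M0.
  by rewrite addn1.
nia.
Qed.

End Layer.

(** * Numbering, links, order and degree of the DCell *)

Lemma dcell_order0 (n : nat) : dcell_order n 0 = n.
Proof. exact: card_ord. Qed.

Lemma dcell_orderS (n k : nat) :
  dcell_order n k.+1 = (dcell_order n k).+1 * dcell_order n k.
Proof. by rewrite /dcell_order /= card_prod card_ord. Qed.

Lemma dcell_uid_lt (n k : nat) (x : dcell_vertex n k) :
  dcell_uid x < dcell_order n k.
Proof.
elim: k x => [|k IH] x; first by rewrite dcell_order0 ltn_ord.
case: x => i u; rewrite dcell_orderS mulSn /=.
have iT : i <= dcell_order n k by rewrite -ltnS ltn_ord.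
by rewrite -addSn leq_add ?IH // leq_mul2r iT orbT.
Qed.

Lemma dcell_uid_inj (n k : nat) : injective (@dcell_uid n k).
Proof.
elim: k => [|k IH] x y; first by move=> /val_inj.
case: x y => [i u] [j v] /= eq_uid.
have uT := dcell_uid_lt u; have vT := dcell_uid_lt v.
have T0 : 0 < dcell_order n k by lia.
congr pair.
  (* Quotient and remainder modulo the order of a copy recover the copy index and the inner uid. *)
  apply/val_inj; have := congr1 (divn^~ (dcell_order n k)) eq_uid.
  by rewrite /= ![_ + _ * _]addnC !divnMDl // !divn_small // !addn0.
by apply: IH; have := congr1 (modn^~ (dcell_order n k)) eq_uid;
   rewrite /= ![_ + _ * _]addnC !modnMDl !modn_small.
Qed.

Lemma dcell_uid_surj (n k m : nat) :
  m < dcell_order n k -> exists x : dcell_vertex n k, dcell_uid x = m.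
Proof.
move=> mT; pose f x := Ordinal (@dcell_uid_lt n k x).
have f_inj : injective f by move=> x y [] /dcell_uid_inj.
have := inj_card_onto f_inj; rewrite card_ord leqnn => /(_ isT (Ordinal mT)).
by move=> /codomP[x [fx]]; exists x.
Qed.

Lemma dcell_adj_same (n k : nat) (i : 'I_(dcell_order n k).+1)
    (u v : dcell_vertex n k) :
  @dcell_adj n k.+1 (i, u) (i, v) = dcell_adj u v.
Proof. by rewrite /= eqxx /dcell_link /= ltnn !orbF. Qed.

Lemma dcell_ports (n k : nat) : 0 < dcell_order n k ->
  exists port : 'I_(dcell_order n k).+1 -> 'I_(dcell_order n k).+1 ->
      dcell_vertex n k,
    (forall i j u v, i != j -> @dcell_adj n k.+1 (i, u) (j, v) =
      (u == port i j) && (v == port j i)) /\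
    (forall i (A : {set dcell_vertex n k}),
      \sum_(j | j != i) (port i j \in A) = #|A|).
Proof.
move=> T0; have [u0 _] := dcell_uid_surj T0.
(* [unbump i j] is [j - 1] for [i < j] and [j] for [j < i], which covers both ends of the link rule.
   The default [u0] can occur only for [i = j]. *)
pose port (i j : 'I_(dcell_order n k).+1) :=
  odflt u0 [pick u : dcell_vertex n k | dcell_uid u == unbump i j].
have uid_port i j : j != i -> dcell_uid (port i j) = unbump i j.
  move=> ji; rewrite /port; case: pickP => [u /eqP // | no].
  have [] := @dcell_uid_surj n k (unbump i j).
    have := ltn_ord i; have := ltn_ord j; move: ji.
    rewrite /unbump -val_eqE /=; lia.
  by move=> u uid_u; have := no u; rewrite uid_u eqxx.
have portP i j u : j != i -> (u == port i j) = (dcell_uid u == unbump i j).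
  by move=> ji; rewrite -(uid_port i j ji) (inj_eq (@dcell_uid_inj n k)).
exists port; split=> [i j u v ij | i A].
  have ji : j != i by rewrite eq_sym.
  rewrite !portP //= (negbTE ij) /dcell_link /= /unbump.
  move: ij {ji}; rewrite -val_eqE /=; case: ltngtP => //= _ _; rewrite !subn0 ?orbF //.
  exact: andbC.
transitivity (\sum_(v in A) \sum_(j | j != i) (v == port i j)).
  rewrite exchange_big; apply: eq_bigr => j _.
  rewrite big_mkcond (bigD1 (port i j)) //= eqxx big1 ?addn0; first by case: ifP.
  by move=> v /negbTE ->; case: ifP.
rewrite -sum1_card; apply: eq_bigr => v _.
(* [lift i] inverts [unbump i] away from [i], so this is the one copy to which [v] is linked. *)
pose j := lift i (Ordinal (dcell_uid_lt v)).
have ji : j != i by rewrite eq_sym neq_lift.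
rewrite (bigD1 j) //= portP // /j /= bumpK eqxx big1 ?addn0 // => l /andP[li lj].
rewrite portP //; apply/eqP; rewrite eqb0; apply: contra lj => /eqP uid_v.
by rewrite -val_eqE /= uid_v unbumpK.
Qed.

Lemma dcell_order_ge (n k : nat) : 1 < n -> n + k <= dcell_order n k.
Proof.
move=> n1; elim: k => [|k IH]; first by rewrite addn0 dcell_order0.
rewrite dcell_orderS; nia.
Qed.

Lemma dcell_order_ge3 (n k : nat) :
  2 < n -> 0 < k -> 3 * (n + k) <= dcell_order n k.
Proof.
case: k => // k n2 _; rewrite dcell_orderS.
have := @dcell_order_ge n k (ltnW n2); nia.
Qed.

Lemma dcell_degree (n k : nat) (x : dcell_vertex n k) :
  1 < n -> \sum_y dcell_adj x y = n + k - 1.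
Proof.
move=> n1; elim: k x => [|k IH] x.
  rewrite (bigD1 x) //= eqxx -[n in RHS]card_ord (cardD1 x) inE /=.
  rewrite addn0 add1n subn1 /= -sum1_card; apply: eq_big => y.
    by rewrite !inE andbT.
  by rewrite eq_sym => ->.
have [|port [adjE cardE]] := @dcell_ports n k.
  by have := @dcell_order_ge n k n1; lia.
have -> : n + k.+1 - 1 = (n + k - 1).+1 by lia.
exact: (degree_layer (@dcell_adj_same n k) adjE cardE (d := n + k - 1)).
Qed.

(** * Isoperimetric bounds for thresholds 1, 2 and 3 *)

Lemma dcell_boundary_small (n k : nat) (A : {set dcell_vertex n k}) :
  1 < n -> #|A| * (n + k - #|A|) <= boundary (@dcell_adj n k) A.
Proof.
move=> n1; have -> : n + k - #|A| = (n + k - 1).+1 - #|A| by lia.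
apply: boundary_small (@dcell_adj_irr n k) _ => x; exact: dcell_degree.
Qed.

Lemma dcell_isoperimetric1 (n k : nat) :
  1 < n -> isoperimetric (@dcell_adj n k) 1 (n + k - 1).
Proof.
move=> n1; elim: k => [|k IH].
  move=> A A0; have := dcell_boundary_small A n1; rewrite card_ord; nia.
have ge_T := @dcell_order_ge n k n1.
have [|port [adjE cardE]] := @dcell_ports n k; first by lia.
have iso1 : isoperimetric (@dcell_adj n k) 1 1.
  by move=> A A0 A1; apply: leq_trans (IH A A0 A1); lia.
apply: (isoperimetric_layer (@dcell_adj_same n k) adjE (@dcell_adj_sym n k.+1)
  _ iso1) => [||X X0 nfull]; [exact: card_ord | by rewrite -/(dcell_order n k); lia |].
have [|[i iX]|[i [j [i0 j0 ijX]]]] :=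
  boundary_sparse (@dcell_adj_same n k) adjE cardE IH nfull X0; first by lia.
  have := IH (slice X i); have := nfull i; lia.
have := IH (slice X i); have := IH (slice X j); have := nfull i; have := nfull j.
lia.
Qed.

(** The induction step shared by thresholds 2 and 3. The premises treat sets of at most [n] vertices
    by degree counting, larger sets inside one copy, and sets meeting two copies; the bound on [c]
    covers three or more copies. *)
Lemma dcell_isoperimetric_layer (n k s c : nat) :
    2 < n -> 0 < k -> 0 < s -> c <= 3 * (n + k - 1) ->
    (forall X : {set dcell_vertex n k.+1}, s <= #|X| <= n ->
      c <= #|X| * (n + k.+1 - #|X|)) ->
    (forall A : {set dcell_vertex n k}, n < #|A| < dcell_order n k ->
      c <= boundary (@dcell_adj n k) A + #|A|) ->
    (forall A B : {set dcell_vertex n k}, 0 < #|A| < dcell_order n k ->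
      0 < #|B| < dcell_order n k -> s <= #|A| + #|B| ->
      c + 2 <= boundary (@dcell_adj n k) A + boundary (@dcell_adj n k) B
               + (#|A| + #|B|)) ->
  isoperimetric (@dcell_adj n k.+1) s c.
Proof.
move=> n2 k0 s0 c_le small one two; have n1 := ltnW n2.
have iso1 := @dcell_isoperimetric1 n k n1.
have ge_T := dcell_order_ge3 n2 k0.
have [|port [adjE cardE]] := @dcell_ports n k; first by lia.
have iso1' : isoperimetric (@dcell_adj n k) 1 1.
  by move=> A A0 A1; apply: leq_trans (iso1 A A0 A1); lia.
apply: (isoperimetric_layer (@dcell_adj_same n k) adjE (@dcell_adj_sym n k.+1)
  _ iso1') => [||X sX nfull].
- exact: card_ord.
- by rewrite -/(dcell_order n k); lia.
have [Xn | Xn] := leqP #|X| n.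
  apply: leq_trans (@dcell_boundary_small n k.+1 X n1).
  by apply: small; rewrite sX.
have [|[i iX b_i]|[i [j [i0 j0 ijX b_ij]]]] :=
  boundary_sparse (@dcell_adj_same n k) adjE cardE iso1 nfull (leq_trans s0 sX).
- exact: leq_trans c_le.
- by apply: leq_trans b_i; rewrite -iX; apply: one; rewrite iX Xn -iX nfull.
rewrite -(leq_add2r 2); apply: leq_trans b_ij; rewrite -ijX; apply: two.
- by rewrite i0 nfull.
- by rewrite j0 nfull.
by rewrite ijX.
Qed.

(** The bound fails for [k = 1]: a single [K_n] then has only [n] boundary edges, fewer than
    [2 * (n - 1)]. *)
Lemma dcell_isoperimetric2 (n k : nat) :
  2 < n -> 1 < k -> isoperimetric (@dcell_adj n k) 2 (2 * (n + k - 2)).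
Proof.
move=> n2; elim: k => [|k IH] // k0.
have iso1 := @dcell_isoperimetric1 n k (ltnW n2).
have ge_T := dcell_order_ge3 n2 k0.
apply: dcell_isoperimetric_layer => // [|X|A An|A B A0 B0 AB]; first by lia.
- nia.
- have := iso1 A; rewrite -/(dcell_order n k).
  (* At [k = 1] there is no induction hypothesis, but [iso1] gives [n] edges and the links more than
     [n], against a target of [2 * n]. *)
  have [k1 | k1] := leqP k 1; first by lia.
  have := IH k1 A; rewrite -/(dcell_order n k); lia.
have := iso1 A; have := iso1 B; rewrite -/(dcell_order n k); lia.
Qed.

(** For [k = 2] and [n > 3] a single [K_n] violates the bound: its boundary is [2 * n], less than
    [3 * (n - 1)]. *)
Lemma dcell_isoperimetric3 (n k : nat) :
  2 < n -> 2 < k -> isoperimetric (@dcell_adj n k) 3 (3 * (n + k - 3)).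
Proof.
move=> n2; elim: k => [|k IH] // k1; have k0 := ltnW k1.
have iso1 := @dcell_isoperimetric1 n k (ltnW n2).
have iso2 := @dcell_isoperimetric2 n k n2 k1.
have ge_T := dcell_order_ge3 n2 k0.
apply: dcell_isoperimetric_layer => // [|X|A An|A B A0 B0 AB]; first by lia.
- nia.
- have := iso1 A; have := iso2 A; rewrite -/(dcell_order n k).
  (* At [k = 2] the target is [3 * n]: [iso2] gives [2 * n] and the links more than [n]. If [iso2]
     does not apply because [A] misses a single vertex, [#|A|] alone suffices. *)
  have [k2 | k2] := leqP k 2; first by lia.
  have := IH k2 A; rewrite -/(dcell_order n k); lia.
(* One of the two traces has at least two vertices, so [iso2] serves for it and [iso1] for the
   other. *)
have := iso1 A; have := iso1 B; have := iso2 A; have := iso2 B.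
rewrite -/(dcell_order n k); lia.
Qed.

(** * Boundaries and restricted edge-cuts *)

Lemma set2_inj (T : finType) (u v x y : T) :
  [set u; v] = [set x; y] -> u = x /\ v = y \/ u = y /\ v = x.
Proof.
move=> eq_uv.
have /set2P u_xy : u \in [set x; y] by rewrite -eq_uv set21.
have /set2P v_xy : v \in [set x; y] by rewrite -eq_uv set22.
have /set2P x_uv : x \in [set u; v] by rewrite eq_uv set21.
have /set2P y_uv : y \in [set u; v] by rewrite eq_uv set22.
by case: u_xy v_xy x_uv y_uv => -> [] -> [] ? [] ?; auto.
Qed.

(** Every edge leaving [A] lies in [F], and such an edge determines its ordered pair because only
    one end is in [A]. *)
Lemma boundary_le_cut (G : sgraph) (F : {set {set G}}) (A : {set G}) :
  (forall x y, x \in A -> y \notin A -> ~~ del_adj F x y) ->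
  boundary (@adj G) A <= #|F|.
Proof.
move=> closedA; rewrite boundary_card.
set P := [set p | _]; pose f (p : G * G) := [set p.1; p.2].
have f_inj : {in P &, injective f}.
  move=> [x y] [x' y']; rewrite !inE /= => /and3P[_ xA yA] /and3P[_ xA' yA'].
  by case/set2_inj => /= [[-> ->] | [xy' _]] //; rewrite -xy' xA in yA'.
rewrite -(card_in_imset f_inj); apply/subset_leq_card/subsetP => s.
move=> /imsetP[[x y] + ->]; rewrite inE /= => /and3P[xy xA yA].
by have := closedA x y xA yA; rewrite /del_adj xy negbK.
Qed.

Lemma restricted_cut_ge (G : sgraph) (h c : nat) (F : {set {set G}}) :
  isoperimetric (@adj G) h c -> restricted_edge_cut h F -> c <= #|F|.
Proof.
move=> iso [_ disc comp_ge].
have [/forallP conn | ] :=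
  boolP [forall x, [forall y, connect (del_adj F) x y]].
  by case: disc => x y; have /forallP := conn x; apply.
rewrite negb_forall => /existsP[x]; rewrite negb_forall => /existsP[y xy].
(* The component of [x]; that of [y] lies in its complement, so both sides have at least [h]
   vertices. *)
pose A : {set G} := [set z | connect (del_adj F) x z].
have hA : h <= #|A| by exact: comp_ge x.
have hB : h <= #|~: A|.
  apply: leq_trans (comp_ge y) _; apply/subset_leq_card/subsetP => z.
  rewrite !inE => yz; apply: contra xy => xz; apply: connect_trans xz _.
  by rewrite (sym_connect_sym (@del_adj_sym G F)).
have AG : #|A| + h <= #|G| by rewrite -(cardsC A) leq_add2l.
apply: leq_trans (iso A hA AG) _; apply: boundary_le_cut => u v.
rewrite !inE => xu; apply: contra => uv.
exact: connect_trans xu (connect1 uv).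
Qed.

Definition edge_boundary (G : sgraph) (A : {set G}) : {set {set G}} :=
  [set [set p.1; p.2] | p : G * G &
    [&& adj p.1 p.2, p.1 \in A & p.2 \notin A]].

Lemma mem_edge_boundary (G : sgraph) (A : {set G}) (x y : G) :
  adj x y -> ([set x; y] \in edge_boundary A) = ((x \in A) != (y \in A)).
Proof.
move=> xy; apply/imsetP/idP => [[[u v]] | xyA].
  rewrite inE /= => /and3P[_ uA /negbTE vA].
  by case/set2_inj => [] [-> ->]; rewrite uA vA.
case xA : (x \in A) xyA => /= yA.
  by exists (x, y); rewrite // inE /= xy xA; case: (y \in A) yA.
exists (y, x); last by rewrite setUC.
by rewrite inE /= adj_sym xy xA; case: (y \in A) yA.
Qed.

(** The clique [A] stays connected. A vertex outside loses at most [#|A|] neighbours, so by the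
    degree hypothesis it keeps at least [h - 1]. *)
Lemma edge_boundary_restricted_cut (G : sgraph) (h : nat) (A : {set G}) :
    0 < h <= #|A| -> #|A| < #|G| ->
    {in A &, forall x y, x != y -> adj x y} ->
    (forall x : G, h + #|A| <= (\sum_y adj x y).+1) ->
  restricted_edge_cut h (edge_boundary A).
Proof.
move=> /andP[h0 hA] AG clique deg; set F := edge_boundary A.
have del_same x y : adj x y -> (x \in A) = (y \in A) -> del_adj F x y.
  by move=> xy xyA; rewrite /del_adj xy mem_edge_boundary // xyA eqxx.
split=> [|conn|/= x].
- apply/subsetP => _ /imsetP[p + ->]; rewrite inE => /and3P[xy _ _].
  by apply/imsetP; exists p; rewrite ?inE.
- have /card_gt0P[x xA] : 0 < #|A| by apply: leq_trans h0 hA.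
  have /card_gt0P[y] : 0 < #|~: A| by have := cardsC A; lia.
  rewrite inE -(closed_connect _ (conn x y)) ?xA // => u v /andP[uv].
  by rewrite mem_edge_boundary // negbK => /eqP.
pose N : {set G} := [set y | @adj G x y && ((y \in A) == (x \in A))].
have sub_comp : x |: N \subset @component (del_edges F) x.
  apply/subsetP => y; rewrite !inE => /predU1P[-> | /andP[xy /eqP/esym xyA]].
    exact: connect0.
  exact/connect1/del_same.
apply: leq_trans (subset_leq_card sub_comp).
have [xA | xA] := boolP (x \in A).
  apply: leq_trans hA _; apply/subset_leq_card/subsetP => y yA.
  by rewrite !inE yA xA; case: eqVneq => //= yx; rewrite clique // eq_sym.
rewrite cardsU1 inE adj_irr /= add1n.
rewrite -(leq_add2r #|A|); apply: leq_trans (deg x) _.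
rewrite addSn ltnS (card_nbrs_split _ A) addnC leq_add //.
  rewrite -sum1_card big_mkcond [X in _ <= X]big_mkcond; apply: leq_sum => y _.
  by rewrite !inE (negbTE xA); case: (y \in A); case: (adj x y).
by rewrite -sum1_card; apply: leq_sum => y _; case: (adj x y).
Qed.

(** * An optimal cut around a triangle *)

Lemma dcell_triangle (n k : nat) : 2 < n ->
  exists2 A : {set dcell_vertex n k}, #|A| = 3 &
    {in A &, forall x y, x != y -> dcell_adj x y}.
Proof.
move=> n2; elim: k => [|k [A A3 clique]].
  exists [set widen_ord n2 i | i : 'I_3] => //.
  by rewrite card_imset ?card_ord // => i j /(congr1 val) /= /val_inj.
pose f (u : dcell_vertex n k) : dcell_vertex n k.+1 := (ord0, u).
exists (f @: A); first by rewrite card_imset // => u v [].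
move=> _ _ /imsetP[u uA ->] /imsetP[v vA ->] uv.
by rewrite dcell_adj_same clique //; apply: contra uv => /eqP ->.
Qed.

Theorem theorem10 (n k : nat) (hn : 3 <= n) (hk : 3 <= k) :
  restricted_edge_connectivity_is 3 (dcell n k) (3 * n + 3 * k - 9).
Proof.
have iso3 := dcell_isoperimetric3 hn hk.
have -> : 3 * n + 3 * k - 9 = 3 * (n + k - 3) by lia.
split; last by move=> F; apply: restricted_cut_ge.
have n1 := ltnW hn; have deg x := @dcell_degree n k x n1.
have [A A3 clique] := @dcell_triangle n k hn.
have cutF : @restricted_edge_cut 3 (dcell n k) (edge_boundary (A : {set dcell n k})).
  apply: edge_boundary_restricted_cut => // [||x]; rewrite A3 //.
    by apply: leq_trans (@dcell_order_ge n k n1); lia.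
  by rewrite deg; lia.
exists (edge_boundary (A : {set dcell n k})) => //.
(* The lower bound applies to this cut too, so only an upper bound on its size remains; counting
   ordered boundary pairs gives it. *)
apply/eqP; rewrite eqn_leq (restricted_cut_ge _ cutF) // andbT.
apply: leq_trans (leq_imset_card _ _) _; rewrite -boundary_card.
rewrite (boundary_clique (@dcell_adj_irr n k) deg clique) A3; lia.
Qed.
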